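(* Let $A$ be a finitely generated free group and let $T$ be its Cayley graph with respect to a free basis. Let $B$ be a group, $\varphi:A\to\mathrm{Aut}(B)$ a homomorphism, and suppose $G=B\rtimes_\varphi A$ is finitely generated. Let $\rho$ be the action of $G$ on $T$ induced by the projection $G\twoheadrightarrow A$ and the natural action of $A$ on $T$. View endpoints of $T$ as infinite reduced words in the basis elements of $A$ and their inverses. Then $\Sigma^1(\rho)$ contains any endpoint represented by an infinite word containing infinitely many mutually distinct subwords lying in $\ker\varphi$.
   Context: **Conventions.** Multiplication in $G=B\rtimes_\varphi A$ is $(b_1,a_1)(b_2,a_2)=(b_1\varphi_{a_1}(b_2),a_1a_2)$. $T$ is a simplicial tree with edges of length 1 and vertex set $A$, and $A$ acts on it by left multiplication. **Rays, words and horoballs.** Points of $\partial T$ are represented uniquely by geodesic rays $\tau:[0,\infty)\to T$ with $\tau(0)=1\in A$; such rays correspond to infinite freely reduced words $c_1c_2c_3\cdots$ in the basis elements and their inverses, via $\tau(k)=c_1\cdots c_k$; $\tau(\infty)$ denotes the endpoint represented by $\tau$. A subword of $c_1c_2\cdots$ is a non-empty block $c_ic_{i+1}\cdots c_j$ ($i\le j$) of consecutive letters, regarded together with its position; ''mutually distinct'' subwords are blocks occurring at distinct (disjoint) positions, and may be equal as words. For real $t$, $HB_t(\tau)=\bigcup_{l\ge\max\{0,t\}}\overline{\mathrm{Ball}_{l-t}(T,\tau(l))}$ (nested union of closed metric balls of radius $l-t$ centred at $\tau(l)$). **$\Sigma^1(\rho)$.** For an isometric action $\rho$ of $G$ on a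 proper CAT(0) space $M$ (here $M=T$), choose a non-empty free contractible $G$-CW-complex $Y$ and a continuous $G$-map $h:Y\to M$. For a geodesic ray $\tau$ and $t\in\mathbb{R}$ let $Y_{(\tau,t)}$ be the largest subcomplex of $Y$ contained in $h^{-1}(HB_t(\tau))$. Then $h$ is controlled connected over $\tau(\infty)$ if for every cocompact $G$-subspace $L\subseteq Y$ there is a cocompact $G$-subspace $L'\supseteq L$ such that for all $t\in\mathbb{R}$ there exists $\lambda(t)\ge0$ with: $( * )$ any two points of $Y_{(\tau,t)}\cap L$ can be connected by a path in $Y_{(\tau,t-\lambda(t))}\cap L'$; and $( ** )$ any two points of $Y_{(\tau,t+\lambda(t))}\cap L$ can be connected by a path in $Y_{(\tau,t)}\cap L'$. By a theorem of Bieri and Geoghegan this does not depend on the choice of $Y$ and $h$, and $\Sigma^1(\rho)$ is the set of $e\in\partial M$ over which $\rho$ is controlled connected. *)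

(* Defs.v *)
From HB Require Import structures.
From mathcomp Require Import all_boot all_order all_algebra.
From mathcomp Require Import all_classical all_reals all_analysis.
From mathcomp Require Import lra.

Set Implicit Arguments.
Unset Strict Implicit.
Unset Printing Implicit Defensive.

Import Order.TTheory GRing.Theory Num.Theory.
Import numFieldNormedType.Exports.

Local Open Scope classical_set_scope.
Local Open Scope ring_scope.

Definition finitely_generated (G : groupType) : Prop :=
  exists s : seq G, forall S : {pred G},
    group_closed S -> {subset s <= S} -> forall g, g \in S.

(* The inverse is uniquely determined by [aut]; carrying it avoids a choice. *)
Record Aut (B : groupType) := MkAut {
  aut :> B -> B;
  aut_inv : B -> B;
  autM : {morph aut : x y / (x * y)%g};
  autK : cancel aut aut_inv;
  aut_invK : cancel aut_inv aut }.

Section AutGroup.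
Context {B : groupType}.
Implicit Types f g h : Aut B.

Lemma aut_eqP f g : f =1 g -> f = g.
Proof.
case: f g => [f f' fM fK f'K] [g g' gM gK g'K] /= /funext E.
rewrite {f}E in fM fK f'K *.
have E' : f' = g' by apply/funext => x; rewrite -[LHS]gK f'K.
rewrite {f'}E' in fK f'K *.
by congr MkAut; exact: Prop_irrelevance.
Qed.

Lemma aut_invM f : {morph aut_inv f : x y / (x * y)%g}.
Proof.
by move=> x y; apply: (can_inj (autK f)); rewrite autM !aut_invK.
Qed.

HB.instance Definition _ := gen_eqMixin (Aut B).
HB.instance Definition _ := gen_choiceMixin (Aut B).

Definition aut1 : Aut B :=
  @MkAut B id id (fun _ _ => erefl) (fun _ => erefl) (fun _ => erefl).

Definition autV f : Aut B := MkAut (@aut_invM f) (aut_invK f) (autK f).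

Lemma aut_compM f g : {morph f \o g : x y / (x * y)%g}.
Proof. by move=> x y /=; rewrite !autM. Qed.

Definition aut_mul f g : Aut B :=
  MkAut (aut_compM f g) (can_comp (autK f) (autK g))
    (can_comp (aut_invK g) (aut_invK f)).

Lemma aut_mulA : associative aut_mul.
Proof. by move=> f g h; apply: aut_eqP. Qed.
Lemma aut_mul1 : left_id aut1 aut_mul.
Proof. by move=> f; apply: aut_eqP. Qed.
Lemma aut_mulr1 : right_id aut1 aut_mul.
Proof. by move=> f; apply: aut_eqP. Qed.
Lemma aut_mulV : left_inverse aut1 autV aut_mul.
Proof. by move=> f; apply: aut_eqP => x /=; rewrite autK. Qed.
Lemma aut_mulrV : right_inverse aut1 autV aut_mul.
Proof. by move=> f; apply: aut_eqP => x /=; rewrite aut_invK. Qed.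

HB.instance Definition _ := isGroup.Build (Aut B)
  aut_mulA aut_mul1 aut_mulr1 aut_mulV aut_mulrV.

End AutGroup.

Definition semidirect (A B : groupType) (phi : {multiplicative A -> Aut B}) : Type :=
  (B * A)%type.

Section SemidirectProduct.
Context {A B : groupType} (phi : {multiplicative A -> Aut B}).
Local Open Scope group_scope.
Local Notation G := (semidirect phi).

HB.instance Definition _ := Choice.on G.

Definition sdmul (x y : G) : G := (x.1 * phi x.2 y.1, x.2 * y.2).
Definition sdone : G := (1, 1).
Definition sdinv (x : G) : G := (phi x.2^-1 x.1^-1, x.2^-1).

Lemma phiM a a' b : phi (a * a') b = phi a (phi a' b).
Proof. by rewrite gmulfM. Qed.
Lemma phi1 b : phi 1 b = b.
Proof. by apply: (can_inj (autK (phi 1))); rewrite -phiM mulg1. Qed.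
Lemma phi_1 a : phi a 1 = 1.
Proof. by apply: (mulgI (phi a 1)); rewrite -autM !mulg1. Qed.

Lemma sdmulA : associative sdmul.
Proof.
move=> [b1 a1] [b2 a2] [b3 a3].
by rewrite /sdmul /= autM phiM !mulgA.
Qed.
Lemma sdmul1 : left_id sdone sdmul.
Proof. by move=> [b a]; rewrite /sdmul /= phi1 !mul1g. Qed.
Lemma sdmulr1 : right_id sdone sdmul.
Proof. by move=> [b a]; rewrite /sdmul /= phi_1 !mulg1. Qed.
Lemma sdmulV : left_inverse sdone sdinv sdmul.
Proof. by move=> [b a]; rewrite /sdmul /= -autM !mulVg phi_1. Qed.
Lemma sdmulrV : right_inverse sdone sdinv sdmul.
Proof. by move=> [b a]; rewrite /sdmul /= -phiM !mulgV phi1 mulgV. Qed.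

HB.instance Definition _ := isGroup.Build G
  sdmulA sdmul1 sdmulr1 sdmulV sdmulrV.

End SemidirectProduct.

Record free_basis (A : groupType) := FreeBasis {
  rank : nat;
  gen :> 'I_rank -> A;
  free_ex : forall (H : groupType) (f : 'I_rank -> H),
    exists psi : {multiplicative A -> H}, forall i, psi (gen i) = f i;
  free_uniq : forall (H : groupType) (psi psi' : {multiplicative A -> H}),
    (forall i, psi (gen i) = psi' (gen i)) -> psi =1 psi' }.
Arguments free_ex {A} X {H} f : rename.
Arguments free_uniq {A} X {H} psi psi' _ _ : rename.

Section Words.
Context {A : groupType} (X : free_basis A).

(* [(i, false)] is the i-th basis element and [(i, true)] its inverse. *)
Definition letter : Type := ('I_(rank X) * bool)%type.

Definition letter_val (l : letter) : A := if l.2 then ((X l.1)^-1)%g else X l.1.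

Definition letter_inv (l : letter) : letter := (l.1, ~~ l.2).

Definition word_val (w : seq letter) : A := (\prod_(l <- w) letter_val l)%g.

Record infinite_word := InfiniteWord {
  letter_at :> nat -> letter;
  reducedP : forall k, letter_at k.+1 <> letter_inv (letter_at k) }.

(* The value of the block of letters at positions i, i + 1, ..., j. *)
Definition block_val (w : infinite_word) (i j : nat) : A :=
  (\prod_(i <= k < j.+1) letter_val (w k))%g.

Definition prefix_val (w : infinite_word) (k : nat) : A :=
  (\prod_(0 <= j < k) letter_val (w j))%g.

Lemma letter_valV l : letter_val (letter_inv l) = ((letter_val l)^-1)%g.
Proof. by case: l => i [] //=; rewrite /letter_val /= invgK. Qed.

Lemma word_val_cat u v : word_val (u ++ v) = (word_val u * word_val v)%g.
Proof. by rewrite /word_val big_cat. Qed.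

Lemma word_valV u : word_val (rev (map letter_inv u)) = ((word_val u)^-1)%g.
Proof.
elim: u => [|l u IH]; first by rewrite /word_val !big_nil invg1.
rewrite /= rev_cons -cats1 word_val_cat IH /word_val !big_cons big_nil mulg1.
by rewrite letter_valV invgM.
Qed.

Definition spelled : {pred A} := fun a => `[< exists w, word_val w = a >].

Lemma spelled_closed : group_closed spelled.
Proof.
split=> [|a b /asboolP[u <-] /asboolP[v <-]].
  by apply/asboolP; exists [::]; rewrite /word_val big_nil.
apply/asboolP; exists (u ++ rev (map letter_inv v)).
by rewrite word_val_cat word_valV.
Qed.

Definition spelled_type : Type := {a : A | spelled a}.
HB.instance Definition _ := SubChoice.on spelled_type.
HB.instance Definition _ :=
  SubChoice_isSubGroup.Build A spelled spelled_type spelled_closed.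

Lemma spelledT a : exists w, word_val w = a.
Proof.
have sX i : spelled (X i).
  apply/asboolP; exists [:: (i, false)].
  by rewrite /word_val big_cons big_nil mulg1.
have [psi psiX] := free_ex X (fun i => Sub (X i) (sX i) : spelled_type).
pose iota : {multiplicative A -> A} := (val : spelled_type -> A) \o psi.
have /(_ a) : iota =1 (idfun : {multiplicative A -> A}).
  by apply: (free_uniq X) => i; rewrite /iota /= psiX.
by move=> /= <-; apply/asboolP; exact: (valP (psi a)).
Qed.

End Words.

Section WordMetric.
Context {A : groupType} (X : free_basis A).

Lemma word_length_subproof a :
  exists n, `[< exists w : seq (letter X), size w = n /\ word_val w = a >].
Proof.
by have [w wa] := spelledT X a; exists (size w); apply/asboolP; exists w.
Qed.

Definition word_length (a : A) : nat := ex_minn (word_length_subproof a).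

Definition word_dist (a b : A) : nat := word_length (a^-1 * b)%g.

Lemma word_length_le (w : seq (letter X)) :
  (word_length (word_val w) <= size w)%N.
Proof.
rewrite /word_length; case: ex_minnP => m _; apply.
by apply/asboolP; exists w.
Qed.

Lemma word_lengthP a :
  exists w : seq (letter X), size w = word_length a /\ word_val w = a.
Proof. by rewrite /word_length; case: ex_minnP => m /asboolP. Qed.

Lemma word_dist0 a : word_dist a a = 0%N.
Proof.
apply/eqP; rewrite -leqn0 /word_dist mulVg.
by have := word_length_le [::]; rewrite /word_val big_nil.
Qed.

Lemma word_dist_eq0 a b : word_dist a b = 0%N -> a = b.
Proof.
rewrite /word_dist => d0; have [w []] := word_lengthP (a^-1 * b)%g.
rewrite d0 => /size0nil -> ; rewrite /word_val big_nil => /esym ab.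
by apply: (mulgI (a^-1)%g); rewrite ab mulVg.
Qed.

Lemma word_dist_le_sym a b : (word_dist b a <= word_dist a b)%N.
Proof.
rewrite /word_dist; have [w [<- wE]] := word_lengthP (a^-1 * b)%g.
have -> : (b^-1 * a)%g = word_val (rev (map (@letter_inv _ X) w)).
  by rewrite word_valV wE invgM invgK.
by rewrite (leq_trans (word_length_le _))// size_rev size_map.
Qed.

Lemma word_dist_sym a b : word_dist a b = word_dist b a.
Proof. by apply/eqP; rewrite eqn_leq !word_dist_le_sym. Qed.

Lemma word_dist_triangle b a c :
  (word_dist a c <= word_dist a b + word_dist b c)%N.
Proof.
rewrite /word_dist; have [u [<- uE]] := word_lengthP (a^-1 * b)%g.
have [v [<- vE]] := word_lengthP (b^-1 * c)%g.
have -> : (a^-1 * c)%g = word_val (u ++ v).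
  by rewrite word_val_cat uE vE mulgA mulgK.
by rewrite (leq_trans (word_length_le _))// size_cat.
Qed.

Lemma word_dist_edge a i : (word_dist a (a * X i)%g <= 1)%N.
Proof.
rewrite /word_dist mulKg.
by have := word_length_le [:: (i, false)]; rewrite /word_val big_seq1.
Qed.

Lemma word_dist_mull g a b : word_dist (g * a)%g (g * b)%g = word_dist a b.
Proof. by rewrite /word_dist invgM -mulgA mulKg. Qed.

End WordMetric.

(* A point of the Cayley graph is a vertex or an interior point of an edge;
   [EdgePoint a i s] lies at distance s from a on the edge from a to a * X i. *)
Inductive cayley_tree (R : realType) (A : groupType) (X : free_basis A) : Type :=
  | Vertex of A
  | EdgePoint of A & 'I_(rank X) & {s : R | 0 < s < 1}.
Arguments Vertex {R A X}.
Arguments EdgePoint {R A X}.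

Section CayleyTree.
Context {R : realType} {A : groupType} (X : free_basis A).
Local Notation T := (cayley_tree R X).

HB.instance Definition _ := gen_eqMixin T.
HB.instance Definition _ := gen_choiceMixin T.

(* [leg p u x]: the vertex u is reached from p along a piece of length x of the
   edge containing p. *)
Inductive leg : T -> A -> R -> Prop :=
  | leg_vertex a : leg (Vertex a) a 0
  | leg_origin a i s : leg (EdgePoint a i s) a (val s)
  | leg_target a i s : leg (EdgePoint a i s) (a * X i)%g (1 - val s).

(* Lengths of the paths from p to q that either stay inside an open edge or
   leave p by a leg, follow a shortest edge path, and enter q by a leg. *)
Inductive route : T -> T -> R -> Prop :=
  | route_edge a i s s' :
      route (EdgePoint a i s) (EdgePoint a i s') `|val s - val s'|
  | route_via p q u v x y : leg p u x -> leg q v y ->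
      route p q (x + (word_dist X u v)%:R + y).

Definition path_dist (p q : T) : R := inf [set l | route p q l].

Lemma leg_ge0 p u x : leg p u x -> 0 <= x.
Proof. by case=> // a i [s /= /andP[s0 s1]]; lra. Qed.

Lemma leg_ex p : exists u x, leg p u x.
Proof.
by case: p => [a|a i s]; [exists a, 0 | exists a, (val s)]; constructor.
Qed.

Lemma route_ge0 p q l : route p q l -> 0 <= l.
Proof.
case=> // {}p {}q u v x y /leg_ge0 x0 /leg_ge0 y0.
by rewrite !addr_ge0.
Qed.

Lemma route_ex p q : exists l, route p q l.
Proof.
have [u [x ux]] := leg_ex p; have [v [y vy]] := leg_ex q.
by exists (x + (word_dist X u v)%:R + y); constructor.
Qed.

Lemma route_has_inf p q : has_inf [set l | route p q l].
Proof.
split; first by have [l ?] := route_ex p q; exists l.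
by exists 0 => l /route_ge0.
Qed.

Lemma path_dist_le p q l : route p q l -> path_dist p q <= l.
Proof. by move=> pql; apply: ge_inf => //; have [] := route_has_inf p q. Qed.

Lemma le_path_dist p q c : (forall l, route p q l -> c <= l) -> c <= path_dist p q.
Proof.
by move=> cl; apply: lb_le_inf; [have [] := route_has_inf p q | exact: cl].
Qed.

Lemma path_dist_ge0 p q : 0 <= path_dist p q.
Proof. by apply: le_path_dist => l /route_ge0. Qed.

Lemma route_sym p q l : route p q l -> route q p l.
Proof.
case=> [a i s s'|{}p {}q u v x y ux vy]; first by rewrite distrC; constructor.
have -> : x + (word_dist X u v)%:R + y = y + (word_dist X v u)%:R + x.
  by rewrite word_dist_sym; lra.
exact: (route_via vy ux).
Qed.

Lemma path_dist_sym p q : path_dist p q = path_dist q p.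
Proof.
by congr inf; apply/seteqP; split=> l /= /route_sym.
Qed.

Lemma leg_leg p u v x y : leg p u x -> leg p v y ->
  (word_dist X u v)%:R <= x + y.
Proof.
have e1 a i : (word_dist X a (a * X i)%g)%:R <= 1 :> R.
  by rewrite lern1 word_dist_edge.
case=> [a|a i s|a i s] lv; inversion lv; subst; rewrite ?word_dist0 ?addr0 //.
- have /andP[s0 s1] := valP s; lra.
- by rewrite (le_trans (e1 _ _))//; lra.
- by rewrite word_dist_sym (le_trans (e1 _ _))//; lra.
- have /andP[s0 s1] := valP s; lra.
Qed.

Lemma leg_shift a i s s' u x : leg (EdgePoint a i s) u x ->
  exists2 y, leg (EdgePoint a i s') u y & y <= x + `|val s - val s'|.
Proof.
move=> l; inversion l; subst.
- exists (val s'); first exact: leg_origin.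
  by rewrite -lerBlDl (le_trans (ler_norm _))// distrC.
- exists (1 - val s'); first exact: leg_target.
  have := ler_norm (val s - val s'); lra.
Qed.

Lemma route_triangle p m q l l' : route p m l -> route m q l' ->
  exists2 k, route p q k & k <= l + l'.
Proof.
case=> [a i s s'|{}p {}m u v x y pu mv].
  move=> mq; inversion mq as [b j r r'|p0 q0 u v x y mu qv]; subst.
    exists `|val s - val r'|; first exact: route_edge.
    exact: ler_distD.
  have [z pz zle] := leg_shift s mu.
  exists (z + (word_dist X u v)%:R + y); first exact: route_via.
  by rewrite distrC in zle; lra.
move=> mq; inversion mq as [b j r r'|p0 q0 u' v' x' y' mu' qv']; subst.
  have [z qz zle] := leg_shift r' mv.
  by exists (x + (word_dist X u v)%:R + z); [exact: route_via | lra].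
exists (x + (word_dist X u v')%:R + y'); first exact: route_via.
have := leg_leg mv mu'.
have : (word_dist X u v')%:R <= (word_dist X u v)%:R + (word_dist X v v')%:R :> R.
  by rewrite -natrD ler_nat word_dist_triangle.
have : (word_dist X v v')%:R <= (word_dist X v u')%:R + (word_dist X u' v')%:R :> R.
  by rewrite -natrD ler_nat word_dist_triangle.
lra.
Qed.

Lemma path_dist_triangle m p q : path_dist p q <= path_dist p m + path_dist m q.
Proof.
rewrite -lerBlDl; apply: le_path_dist => l' mq.
rewrite lerBlDr -lerBlDl; apply: le_path_dist => l pm.
have [k pq kle] := route_triangle pm mq.
have := path_dist_le pq; lra.
Qed.

Lemma path_distxx p : path_dist p p = 0.
Proof.
apply/eqP; rewrite eq_le path_dist_ge0 andbT; apply: path_dist_le.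
case: p => [a|a i s].
  by have := route_via (leg_vertex a) (leg_vertex a); rewrite word_dist0 !addr0.
by have := route_edge a i s s; rewrite subrr normr0.
Qed.

(* The distance from a point to the nearest vertex, or 1 at a vertex. *)
Definition room (p : T) : R :=
  if p is EdgePoint _ _ s then Num.min (val s) (1 - val s) else 1.

Lemma room_gt0 p : 0 < room p.
Proof.
case: p => [a|a i [s /= /andP[s0 s1]]]; rewrite /room //= lt_min s0 /=; lra.
Qed.

Lemma leg_room p u x : leg p u x -> p = Vertex u /\ x = 0 \/ room p <= x.
Proof.
case=> [a|a i s|a i s]; [by left|right..]; rewrite /room /=.
  by rewrite ge_min lexx.
by rewrite ge_min lexx orbT.
Qed.

Lemma route_room p q l : route p q l -> p <> q ->
  [\/ Num.min (room p) (room q) <= l |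
     exists a i s s', [/\ p = EdgePoint a i s, q = EdgePoint a i s' &
                          l = `|val s - val s'|]].
Proof.
case=> [a i s s' _|{}p {}q u v x y pu qv pq]; first by right; exists a, i, s, s'.
left; rewrite ge_min.
have [[pE x0]|px] := leg_room pu; last first.
  by rewrite (le_trans px)// -addrA lerDl addr_ge0// (leg_ge0 qv).
have [[qE y0]|qy] := leg_room qv; last first.
  by rewrite (le_trans qy) ?orbT// lerDr addr_ge0// (leg_ge0 pu).
rewrite pE qE /room x0 y0 addr0 add0r ler1n lt0n orbb.
apply/eqP => /word_dist_eq0 uv; by apply: pq; rewrite pE qE uv.
Qed.

Lemma path_dist_eq0 p q : path_dist p q = 0 -> p = q.
Proof.
move=> d0; apply: contrapT => pq.
pose gap := match p, q with
  | EdgePoint _ _ s, EdgePoint _ _ s' =>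
      if val s == val s' then 1 else `|val s - val s'|
  | _, _ => 1 end : R.
have gap0 : 0 < gap.
  rewrite {}/gap {d0 pq}; case: p => // a i s; case: q => // b j s'.
  by case: eqVneq => // ne; rewrite normr_gt0 subr_eq0.
have : Num.min (Num.min (room p) (room q)) gap <= path_dist p q.
  apply: le_path_dist => l pql; rewrite ge_min.
  have [->//|[a [i [s [s' [pE qE ->]]]]]] := route_room pql pq.
  apply/orP; right; rewrite /gap pE qE; case: eqVneq => // /val_inj ss'.
  by case: pq; rewrite pE qE ss'.
by rewrite d0 leNgt !lt_min !room_gt0 gap0.
Qed.

HB.instance Definition _ := @isMetric.Build R T path_dist
  path_distxx path_dist_eq0 path_dist_sym path_dist_triangle.

Definition translate (g : A) (p : T) : T :=
  match p with
  | Vertex a => Vertex (g * a)%g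
  | EdgePoint a i s => EdgePoint (g * a)%g i s
  end.

Lemma translate1 p : translate 1%g p = p.
Proof. by case: p => [a|a i s] /=; rewrite mul1g. Qed.

Lemma translateM g g' p : translate (g * g')%g p = translate g (translate g' p).
Proof. by case: p => [a|a i s] /=; rewrite mulgA. Qed.

Lemma leg_translate g p u x : leg p u x -> leg (translate g p) (g * u)%g x.
Proof.
case=> [a|a i s|a i s] /=; first exact: leg_vertex.
  exact: leg_origin.
by rewrite mulgA; exact: leg_target.
Qed.

Lemma route_translate g p q l :
  route p q l -> route (translate g p) (translate g q) l.
Proof.
case=> [a i s s'|{}p {}q u v x y pu qv]; first exact: route_edge.
rewrite -(word_dist_mull X g).
exact: route_via (leg_translate g pu) (leg_translate g qv).
Qed.

Lemma translate_isometry g p q :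
  mdist (translate g p) (translate g q) = mdist p q.
Proof.
congr inf; apply/seteqP; split=> l /= pq; last exact: route_translate.
have := route_translate (g^-1)%g pq.
by rewrite -!translateM mulVg !translate1.
Qed.

(* The point at distance s, clamped to [0, 1], from a on the edge from a to
   a * X i. *)
Definition on_edge (a : A) (i : 'I_(rank X)) (s : R) : T :=
  if insub s is Some s' then EdgePoint a i s'
  else if s <= 0 then Vertex a else Vertex (a * X i)%g.

(* The unit speed ray with ray k = Vertex (c_1 ... c_k).  An inverse letter
   traverses its edge backwards. *)
Definition ray (w : infinite_word X) (l : R) : T :=
  let k := Num.truncn l in
  let s := l - k%:R in
  let: (i, inverted) := w k in
  if inverted then on_edge (prefix_val w k.+1) i (1 - s)
  else on_edge (prefix_val w k) i s.

End CayleyTree.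

(* The library norm on row vectors is the sup norm, so the standard n-cell is
   modelled on the cube [-1, 1]^n. *)
Section Cells.
Context (R : realType) (n : nat).
Definition disk : set 'rV[R]_n := [set x | `|x| <= 1].
Definition open_disk : set 'rV[R]_n := [set x | `|x| < 1].
Definition sphere : set 'rV[R]_n := [set x | `|x| = 1].
End Cells.
Arguments disk {R n}.
Arguments open_disk {R n}.
Arguments sphere {R n}.

(* CW-complexes presented by characteristic maps: [cw_finite] is closure
   finiteness and [cw_weak] is the weak topology. *)
Record CW_complex (R : realType) := MkCW {
  cw_space :> topologicalType;
  cell : Type;
  cell_dim : cell -> nat;
  char_map : forall e : cell, 'rV[R]_(cell_dim e) -> cw_space;
  cw_hausdorff : hausdorff_space cw_space;
  cw_continuous : forall e, {within disk, continuous (@char_map e)};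
  cw_injective : forall e, {in open_disk &, injective (@char_map e)};
  cw_cover : forall y, exists e, (@char_map e @` open_disk) y;
  cw_disjoint : forall e e',
    (@char_map e @` open_disk) `&` (@char_map e' @` open_disk) !=set0 -> e = e';
  cw_finite : forall e, exists F : set cell,
    [/\ finite_set F, forall e', F e' -> (cell_dim e' < cell_dim e)%N &
        @char_map e @` sphere `<=` \bigcup_(e' in F) (@char_map e' @` open_disk)];
  cw_weak : forall Z : set cw_space,
    (forall e, closed (disk `&` @char_map e @^-1` Z)) -> closed Z }.

Section CW.
Context {R : realType} (Y : CW_complex R).

Definition open_cell (e : cell Y) : set Y := @char_map R Y e @` open_disk.
Definition closed_cell (e : cell Y) : set Y := @char_map R Y e @` disk.

(* As the open cells partition Y, such a Z is the union of the open cells it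
   meets. *)
Definition subcomplex (Z : set Y) : Prop :=
  forall e, open_cell e `&` Z !=set0 -> closed_cell e `<=` Z.

Definition largest_subcomplex (S : set Y) : set Y :=
  \bigcup_(Z in [set Z | subcomplex Z /\ Z `<=` S]) Z.

Definition contractible : Prop :=
  exists (y0 : Y) (H : Y * R -> Y),
    [/\ {within [set p | 0 <= p.2 <= 1], continuous H},
        forall y, H (y, 0) = y & forall y, H (y, 1) = y0].

Definition joined_in (P : set Y) (y y' : Y) : Prop :=
  exists c : R -> Y,
    [/\ {within `[0, 1], continuous c}, c 0 = y, c 1 = y' & c @` `[0, 1] `<=` P].

End CW.

(* The group is discrete: its elements permute the open cells, and an element
   that maps an open cell to itself fixes it pointwise. *)
Record GCW_complex (R : realType) (G : groupType) := MkGCW {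
  gcw_cw :> CW_complex R;
  gact : G -> gcw_cw -> gcw_cw;
  gact1 : forall y, gact 1%g y = y;
  gactM : forall g g' y, gact (g * g')%g y = gact g (gact g' y);
  gact_continuous : forall g, continuous (gact g);
  gact_cell : forall g e, exists e', gact g @` open_cell e = open_cell e';
  gact_rigid : forall g (e : cell gcw_cw), gact g @` open_cell e = open_cell e ->
    forall y, open_cell e y -> gact g y = y }.

Section GCW.
Context {R : realType} {G : groupType} (Y : GCW_complex R G).

Definition free_action : Prop := forall g (y : Y), gact g y = y -> g = 1%g.

Definition same_orbit (y y' : Y) : bool := `[< exists g, y' = gact g y >].

Lemma same_orbit_equiv : equiv_class_of same_orbit.
Proof.
split=> [y|y y'|y' y y''].
- by apply/asboolP; exists 1%g; rewrite gact1.
- by apply/asboolP/asboolP => -[g ->]; exists (g^-1)%g; rewrite -gactM mulVg gact1.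
- move=> /asboolP[g ->] /asboolP[g' ->]; apply/asboolP.
  by exists (g' * g)%g; rewrite gactM.
Qed.

Definition orbit_rel : equiv_rel Y := EquivRelPack same_orbit_equiv.

Definition orbit_space : topologicalType :=
  quotient_topology {eq_quot orbit_rel}%qT.

Definition orbit_map (y : Y) : orbit_space := \pi_(orbit_space)%qT y.

Definition cocompact_subspace (L : set Y) : Prop :=
  (forall g, gact g @` L `<=` L) /\ compact (orbit_map @` L).

End GCW.

Record isometric_action (R : realType) (G : groupType) (M : metricType R) :=
  MkIsometricAction {
    iact :> G -> M -> M;
    iact1 : forall p, iact 1%g p = p;
    iactM : forall g g' p, iact (g * g')%g p = iact g (iact g' p);
    iact_isometry : forall g p q, mdist (iact g p) (iact g q) = mdist p q }.

Definition horoball (R : realType) (M : metricType R) (tau : R -> M) (t : R) : set M :=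
  \bigcup_(l in [set l | Num.max 0 t <= l]) [set p | mdist (tau l) p <= l - t].

Section ControlledConnected.
Context {R : realType} {G : groupType} {M : metricType R}.
Variables (rho : isometric_action G M) (Y : GCW_complex R G) (h : Y -> M).

Definition control_map : Prop :=
  continuous h /\ forall g y, h (gact g y) = rho g (h y).

Definition over_horoball (tau : R -> M) (t : R) : set Y :=
  largest_subcomplex (h @^-1` horoball tau t).

Definition controlled_connected (tau : R -> M) : Prop :=
  forall L, cocompact_subspace L ->
  exists L', [/\ cocompact_subspace L', L `<=` L' &
    forall t : R, exists lambda : R, [/\ 0 <= lambda,
      forall y y', (over_horoball tau t `&` L) y ->
        (over_horoball tau t `&` L) y' ->
        joined_in (over_horoball tau (t - lambda) `&` L') y y' &
      forall y y', (over_horoball tau (t + lambda) `&` L) y ->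
        (over_horoball tau (t + lambda) `&` L) y' ->
        joined_in (over_horoball tau t `&` L') y y']].

End ControlledConnected.

(* A boundary point of the Cayley tree is represented by a unique geodesic ray
   from the vertex 1, that is, by a unique infinite freely reduced word.  By a
   theorem of Bieri and Geoghegan, controlled connectivity does not depend on
   the choice of Y and h, so requiring it for every choice is the same as
   requiring it for one; a choice exists for every G since the tree is
   contractible.  [contractible] includes that Y is non-empty. *)
Definition Sigma1 (R : realType) (A G : groupType) (X : free_basis A)
    (rho : isometric_action G (cayley_tree R X)) : set (infinite_word X) :=
  [set w | forall (Y : GCW_complex R G) (h : Y -> cayley_tree R X),
     free_action Y -> contractible Y -> control_map rho h ->
     controlled_connected h (ray w)].

Section SemidirectAction.
Context (R : realType) (A B : groupType) (X : free_basis A).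
Variable phi : {multiplicative A -> Aut B}.

Definition tree_act (g : semidirect phi) (p : cayley_tree R X) := translate g.2 p.

Definition tree_action : isometric_action (semidirect phi) (cayley_tree R X) :=
  @MkIsometricAction R (semidirect phi) (cayley_tree R X) tree_act
    (@translate1 R A X) (fun g g' => @translateM R A X g.2 g'.2)
    (fun g => @translate_isometry R A X g.2).

End SemidirectAction.

(* A block is given by the positions (i, j) of its first and last letters. *)
Definition infinitely_many_subwords_in_kernel (A B : groupType)
    (X : free_basis A) (phi : {multiplicative A -> Aut B})
    (w : infinite_word X) : Prop :=
  exists F : set (nat * nat),
    [/\ infinite_set F,
        forall b, F b -> (b.1 <= b.2)%N /\ phi (block_val w b.1 b.2) = 1%g &
        forall b b', F b -> F b' -> b <> b' -> (b.2 < b'.1)%N \/ (b'.2 < b.1)%N].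

(* Main.v *)
Require Import Defs.
From mathcomp Require Import all_boot all_order all_algebra.
From mathcomp Require Import all_classical all_reals all_analysis.
From mathcomp Require Import lra zify.

(** Write tau for the ray of w and call an element (b, a) of G a vertex over
    a horoball when a lies in it.

    The algebraic heart is that the vertices over any horoball centred at tau
    are connected through the generators of G, by moves that never leave the
    horoball ([connected_horoball]).  Moving in the A-direction is possible
    because a geodesic from a vertex of the horoball to a far away tau(k) stays
    inside ([connected_same_fibre]).  Moving in the B-direction at the vertex c
    multiplies b by phi_c(x), x the B-component of a generator, and the elements
    phi_a(x) with a ranging over the whole of A generate B ([kernel_generated]).  So it
    suffices that each automorphism phi_a is also phi_c for some c in the
    horoball ([same_automorphism_in_horoball]).  This is where the kernel blocks
    enter: erasing m disjoint blocks from the prefix tau(n) gives an element r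
    with phi_r = phi_tau(n) and length at most n - m ([prefix_shortened]), so
    c = tau(n) r^-1 a acts as a does and is within n - m + |a| of tau(n); since m
    is arbitrary, c lies as deep in the horoballs as one likes.

    The rest carries this over to an arbitrary Y and h.  A subset of Y that is
    compact modulo G is covered by the translates of a finite subcomplex
    ([compact_orbit_cover]).  Let y0 be the point to which Y contracts.  A compact
    set containing y0, its images under the generators, and representatives of
    L sweeps out a compact set P under the contraction, and the tracks in P join
    everything to y0 ([contraction_track]).  Then G P is covered by the translates
    of a finite subcomplex K', and L' = G K' works: edges of the Cayley graph of G
    become paths in translates of P.  As h is bounded on P and on K', passing
    between Y and the vertices of T costs a constant amount of horoball depth,
    which serves as lambda for all t; with a constant lambda, the second
    connectivity condition is the first one at t + lambda. *)

Set Implicit Arguments.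
Unset Strict Implicit.
Unset Printing Implicit Defensive.

Import Order.TTheory GRing.Theory Num.Theory.
Import numFieldNormedType.Exports.

Local Open Scope classical_set_scope.
Local Open Scope ring_scope.

(** * Word lengths and distances in the tree *)

Section Prefixes.
Context {A : groupType} {X : free_basis A} (w : infinite_word X).

Lemma prefix_valS k :
  prefix_val w k.+1 = (prefix_val w k * letter_val (w k))%g.
Proof. by rewrite /prefix_val big_nat_recr. Qed.

Lemma word_length_inv (a : A) : word_length X (a^-1)%g = word_length X a.
Proof.
by have := word_dist_sym X a 1%g; rewrite /word_dist mulg1 invg1 mul1g.
Qed.

Lemma word_length_mul (a b : A) :
  (word_length X (a * b)%g <= word_length X a + word_length X b)%N.
Proof.
have := word_dist_triangle X 1%g (a^-1)%g b.
by rewrite /word_dist invgK mulg1 invg1 mul1g.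
Qed.

Lemma word_length_block m n : (m <= n)%N ->
  (word_length X (\prod_(m <= k < n) letter_val (w k))%g <= n - m)%N.
Proof.
move=> mn; have := word_length_le [seq w k | k <- index_iota m n].
by rewrite size_map size_iota /word_val big_map.
Qed.

Lemma word_dist_prefix m n : (m <= n)%N ->
  (word_dist X (prefix_val w m) (prefix_val w n) <= n - m)%N.
Proof.
move=> mn; rewrite /word_dist {2}/prefix_val (big_cat_nat (n := m)) //=.
by rewrite mulKg word_length_block.
Qed.

End Prefixes.

Section TreeDistances.
Context (R : realType) {A : groupType} {X : free_basis A}.
Local Notation T := (cayley_tree R X).

Lemma mdist_vertex (a b : A) :
  mdist (Vertex a : T) (Vertex b) = (word_dist X a b)%:R.
Proof.
apply/eqP; rewrite eq_le; apply/andP; split.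
  have := path_dist_le (R := R) (route_via (leg_vertex X a) (leg_vertex X b)).
  by rewrite add0r addr0.
apply: le_path_dist => l r; inversion r as [|p q u v x y ra rb]; subst.
by inversion ra; inversion rb; subst; rewrite add0r addr0.
Qed.

Lemma mdist_on_edge_target (a : A) i (s : R) : 0 <= s <= 1 ->
  mdist (on_edge a i s : T) (Vertex (a * X i)%g) <= 1 - s.
Proof.
move=> /andP[s0 s1]; rewrite /on_edge; case: insubP => [s' _ <-|].
  have := path_dist_le (R := R)
    (route_via (leg_target a i s') (leg_vertex X (a * X i)%g)).
  by rewrite word_dist0 !addr0.
case: ifP => [s0' _|/negbT s0'].
  rewrite mdist_vertex; have -> : s = 0 by apply/eqP; rewrite eq_le s0 s0'.
  by rewrite subr0 lern1 word_dist_edge.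
by rewrite ltNge s0' /= -leNgt => s1'; rewrite mdistxx; lra.
Qed.

Lemma mdist_on_edge_origin (a : A) i (s : R) : 0 <= s <= 1 ->
  mdist (on_edge a i s : T) (Vertex a) <= s.
Proof.
move=> /andP[s0 s1]; rewrite /on_edge; case: insubP => [s' _ <-|].
  have := path_dist_le (R := R)
    (route_via (leg_origin a i s') (leg_vertex X a)).
  by rewrite word_dist0 !addr0.
case: ifP => [s0' _|/negbT s0']; first by rewrite mdistxx.
rewrite ltNge s0' /= -leNgt => s1'.
by rewrite mdist_vertex word_dist_sym (le_trans _ s1') // lern1 word_dist_edge.
Qed.

Context (w : infinite_word X).

Lemma mdist_ray_next (l : R) : 0 <= l ->
  mdist (ray w l : T) (Vertex (prefix_val w (Num.truncn l).+1)) <=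
    (Num.truncn l).+1%:R - l.
Proof.
move=> l0; have /andP[l1 l2] := truncn_itv l0.
rewrite -natr1 in l2 *; rewrite /ray.
case E: (w _) => [i []].
  apply: (le_trans (mdist_on_edge_origin _ _ _)); lra.
rewrite prefix_valS E.
apply: (le_trans (mdist_on_edge_target _ _ _)); lra.
Qed.

Lemma mdist_ray_prefix (l : R) k : 0 <= l -> l < k%:R ->
  mdist (ray w l : T) (Vertex (prefix_val w k)) <= k%:R - l.
Proof.
move=> l0 lk; have /andP[l1 l2] := truncn_itv l0.
have nk : (Num.truncn l < k)%N by rewrite -(ltr_nat R) (le_lt_trans l1).
pose v : T := Vertex (prefix_val w (Num.truncn l).+1).
apply: le_trans (metric_triangle _ v _) _.
have := mdist_ray_next l0; rewrite mdist_vertex.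
have : (word_dist X (prefix_val w (Num.truncn l).+1) (prefix_val w k))%:R <=
    k%:R - (Num.truncn l).+1%:R :> R.
  by rewrite -natrB // ler_nat word_dist_prefix.
lra.
Qed.

Lemma ray_nat (k : nat) : ray w k%:R = Vertex (prefix_val w k) :> T.
Proof.
rewrite /ray natrK subrr; case E: (w k) => [i []].
  rewrite prefix_valS E /letter_val /= /on_edge insubN ?subr0 ?ltxx ?andbF//.
  by rewrite leNgt ltr01 /= -mulgA mulVg mulg1.
by rewrite /on_edge insubN ?ltxx// lexx.
Qed.

End TreeDistances.

(** * Vertices in a horoball *)

Lemma horoball_mdist (R : realType) (M : metricType R) (tau : R -> M)
    (t d : R) p q :
  mdist p q <= d -> horoball tau t p -> horoball tau (t - d) q.
Proof.
move=> pq [l /= tl lp]; have d0 := le_trans (mdist_ge0 p q) pq.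
exists l => /=.
  by move: tl; rewrite !ge_max => /andP[-> /= tl]; lra.
by apply: le_trans (metric_triangle _ p _) _; lra.
Qed.

Section VerticesOfHoroballs.
Context (R : realType) {A : groupType} {X : free_basis A} (w : infinite_word X).
Local Notation T := (cayley_tree R X).

Lemma horoball_vertexI (t : R) c k :
  (word_dist X c (prefix_val w k))%:R <= k%:R - t ->
  horoball (ray w : R -> T) t (Vertex c).
Proof.
move=> ck; exists k%:R => /=.
  rewrite ge_max ler0n /=.
  by have := ler0n R (word_dist X c (prefix_val w k)); lra.
by rewrite ray_nat mdist_vertex word_dist_sym.
Qed.

(** The defining condition at some real parameter l of the ray persists at all
    later parameters, in particular at all large integers, where it becomes a
    condition on word lengths. *)
Lemma horoball_vertexE (t : R) c :
  horoball (ray w : R -> T) t (Vertex c) ->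
  exists N, forall k, (N <= k)%N ->
    (word_dist X c (prefix_val w k))%:R <= k%:R - t.
Proof.
move=> [l /=]; rewrite ge_max => /andP[l0 tl] lc.
exists (Num.truncn l).+1 => k Nk; rewrite word_dist_sym -(mdist_vertex R).
have lk : l < k%:R.
  have /andP[_ l2] := truncn_itv l0.
  by apply: lt_le_trans l2 _; rewrite ler_nat.
apply: le_trans (metric_triangle _ (ray w l) _) _.
by have := mdist_ray_prefix w l0 lk; rewrite metric_sym; lra.
Qed.

End VerticesOfHoroballs.

(** * Erasing kernel blocks *)

Section KernelBlocks.
Context {A B : groupType} {X : free_basis A}.
Context (phi : {multiplicative A -> Aut B}).
Context (w : infinite_word X) (wker : infinitely_many_subwords_in_kernel phi w).

(** Pairwise disjoint blocks start at distinct positions, so infinitely many of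
    them cannot all start before n. *)
Lemma kernel_block_beyond n : exists i j,
  [/\ (n <= i)%N, (i <= j)%N & phi (block_val w i j) = 1%g].
Proof.
have [F [Finf Fker Fdisj]] := wker.
have finj : {in F &, injective fst}.
  move=> b b' /set_mem Fb /set_mem Fb' bb'; apply: contrapT => ne.
  have [/= le _] := Fker _ Fb; have [/= le' _] := Fker _ Fb'.
  by case: (Fdisj _ _ Fb Fb' ne); lia.
have [b Fb nb] : exists2 b, F b & (n <= b.1)%N.
  apply: contrapT => noB; apply: Finf.
  rewrite -(eq_finite_set (inj_card_eq finj)).
  apply: (sub_finite_set _ (finite_II n)) => _ [b Fb <-] /=.
  by rewrite ltnNge; apply/negP => nb; apply: noB; exists b.
by have [le ker] := Fker _ Fb; exists b.1, b.2.
Qed.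

(** Erasing a block in the kernel does not change the automorphism, and the
    erased blocks are disjoint and non-empty: m of them shorten a prefix by at
    least m.  Each step keeps the letters up to the next block beyond n. *)
Lemma prefix_shortened m : exists n r,
  (word_length X r + m <= n)%N /\ phi r = phi (prefix_val w n).
Proof.
elim: m => [|m [n [r [rn phir]]]].
  exists 0%N, 1%g; split; last by rewrite /prefix_val big_geq.
  by rewrite addn0 -(word_dist0 X 1%g) /word_dist mulVg.
have [i [j [ni ij ker]]] := kernel_block_beyond n.
have := word_length_block w ni; set v := (\prod_(n <= k < i) _)%g => vni.
exists j.+1, (r * v)%g; split.
  apply: leq_trans (leq_add (word_length_mul _ _) (leqnn _)) _.
  by move: (word_length X v) vni => d; lia.
rewrite /prefix_val (big_cat_nat (n := n)) //=; last by lia.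
rewrite (big_cat_nat (m := n) (n := i)) //=; last by lia.
by rewrite !gmulfM phir -/(prefix_val w n) -/(block_val w i j) ker mulg1.
Qed.

(** The witness is c = tau(n) r^-1 a, with r the shortening of tau(n) by at least
    t + |a| letters: its distance to tau(n) is at most |r| + |a| <= n - t. *)
Lemma same_automorphism_in_horoball (R : realType) (t : R) a : exists c,
  horoball (ray w : R -> cayley_tree R X) t (Vertex c) /\ phi c = phi a.
Proof.
have [m tm] : exists m : nat, t + (word_length X a)%:R <= m%:R.
  have [n] := archi_boundP  (normr_ge0 (t + (word_length X a)%:R)); eexists.
  by apply: le_trans (ler_norm _) _; apply: ltW; eassumption.
have [n [r [rn phir]]] := prefix_shortened m.
exists (prefix_val w n * r^-1 * a)%g; split; last first.
  by rewrite -mulgA gmulfM -phir -gmulfM mulVKg.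
apply: (@horoball_vertexI _ _ _ _ _ _ n).
rewrite word_dist_sym /word_dist -!mulgA mulKg.
have := word_length_mul (X := X) (r^-1)%g a; rewrite word_length_inv => le.
have : (word_length X (r^-1 * a)%g + m <= n + word_length X a)%N.
  by apply: leq_trans (leq_add le (leqnn m)) _; rewrite addnAC leq_add2r.
rewrite -(ler_nat R) !natrD; lra.
Qed.

End KernelBlocks.

(** * Connecting the vertices over a horoball *)

Lemma aut_morphV (B : groupType) (f : Aut B) b : f (b^-1)%g = ((f b)^-1)%g.
Proof.
have f1 : f 1%g = 1%g by apply: (mulgI (f 1%g)); rewrite -autM !mulg1.
by apply: (mulIg (f b)); rewrite mulVg -autM mulVg.
Qed.

Lemma semidirect_mulE (A B : groupType) (phi : {multiplicative A -> Aut B})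
    b c b' c' :
  (((b, c) : semidirect phi) * ((b', c') : semidirect phi))%g =
  ((b * phi c b')%g, (c * c')%g).
Proof. by []. Qed.

Section VertexConnectivity.
Context (R : realType) {A B : groupType} {X : free_basis A}.
Context (phi : {multiplicative A -> Aut B}).
Context (w : infinite_word X) (wker : infinitely_many_subwords_in_kernel phi w).
Local Notation G := (semidirect phi).
Local Notation over t c :=
  (horoball (ray w : R -> cayley_tree R X) t (Vertex c)).

Lemma semidirect_kernel_closed (N : {pred B}) :
  group_closed N -> (forall a b, b \in N -> phi a b \in N) ->
  group_closed [pred g : G | g.1 \in N].
Proof.
move=> [N1 NV] Nphi; split=> [|[b a] [b' a'] Nb Nb']; first exact: N1.
change ((b * phi a (phi (a'^-1)%g (b'^-1)%g))%g \in N).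
by rewrite -phiM aut_morphV; apply: NV => //; apply: Nphi.
Qed.

(** The largest subset of S stable under all phi_a is a subgroup N of B, and N x A
    is a subgroup of the semidirect product that contains the generators. *)
Lemma kernel_generated (s : seq G) (S : {pred B}) :
  (forall S : {pred G},
    group_closed S -> {subset s <= S} -> forall g, g \in S) ->
  group_closed S -> (forall a g, g \in s -> phi a g.1 \in S) ->
  forall b, b \in S.
Proof.
move=> sG Sgrp Ss b.
pose N : {pred B} := fun b => `[< forall a, phi a b \in S >].
have : ((b, 1%g) : G) \in [pred g : G | g.1 \in N].
  apply: sG.
    apply: semidirect_kernel_closed.
      case: Sgrp => S1 SV; split.
        by apply/asboolP => a; rewrite phi_1.
      move=> x y /asboolP Nx /asboolP Ny; apply/asboolP => a.
      by rewrite autM aut_morphV; apply: SV.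
    by move=> a x /asboolP Nx; apply/asboolP => a'; rewrite -phiM.
  by move=> g gs; apply/asboolP => a; apply: Ss.
by move=> /asboolP /(_ 1%g); rewrite phi1.
Qed.

(* E stands for the relation of being joined by a path in Y over a suitable
   horoball; [E_basis] and [E_gen] are the two kinds of edges of the Cayley graph
   of G. *)
Context (t : R) (E : G -> G -> Prop) (s : seq G).
Context (sG :
  forall S : {pred G}, group_closed S -> {subset s <= S} -> forall g, g \in S).
Context (Exx : forall g : G, over t g.2 -> E g g).
Context (Esym : forall g g', E g g' -> E g' g).
Context (Etrans : forall g' g g'', E g g' -> E g' g'' -> E g g'').
Context (E_basis : forall b c i, over t c -> E (b, c) (b, (c * X i)%g)).
Context (E_gen : forall b c (x : G),
  x \in s -> over t c -> E (b, c) ((b * phi c x.1)%g, c)).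

(** Following u letter by letter from c, the remaining distance to tau(k) drops
    with each letter, so all vertices on the way lie in the ball of radius k - t
    about tau(k), hence in the horoball. *)
Lemma connected_to_ray b c k (u : seq (letter X)) :
  (c * word_val u)%g = prefix_val w k ->
  (size u)%:R <= k%:R - t -> E (b, c) (b, prefix_val w k).
Proof.
elim: u c => [|l u IH] c ck uk.
  move: ck; rewrite /word_val big_nil mulg1 => ck.
  rewrite -ck; apply: Exx => /=.
  by apply: (@horoball_vertexI _ _ _ _ _ _ k); rewrite -ck word_dist0.
have oc : over t c.
  apply: (@horoball_vertexI _ _ _ _ _ _ k); apply: le_trans uk.
  by rewrite ler_nat /word_dist -ck mulKg word_length_le.
have uk' : (size u)%:R <= k%:R - t.
  by apply: le_trans uk; rewrite ler_nat.
have ck' : (c * letter_val l * word_val u)%g = prefix_val w k.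
  by rewrite -ck /word_val big_cons mulgA.
have ocl : over t (c * letter_val l)%g.
  apply: (@horoball_vertexI _ _ _ _ _ _ k); apply: le_trans uk'.
  by rewrite ler_nat /word_dist -ck' mulKg word_length_le.
apply: Etrans (IH _ ck' uk'); case: l ocl {ck ck' uk} => i [] /= ocl.
  by apply: Esym; have := E_basis b i ocl; rewrite mulgVK.
exact: E_basis.
Qed.

Lemma connected_same_fibre b c c' :
  over t c -> over t c' -> E (b, c) (b, c').
Proof.
move=> /horoball_vertexE [N oc] /horoball_vertexE [N' oc'].
pose k := maxn N N'.
have toray d : (word_dist X d (prefix_val w k))%:R <= k%:R - t ->
    E (b, d) (b, prefix_val w k).
  move=> dk; have [u [su uv]] := word_lengthP X (d^-1 * prefix_val w k)%g.
  by apply: (@connected_to_ray _ _ _ u); rewrite ?uv ?mulVKg // su.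
apply: Etrans (toray _ (oc _ (leq_maxl _ _))) _; apply: Esym.
exact: toray (oc' _ (leq_maxr _ _)).
Qed.

(** The elements x of B such that multiplying by x on the right is a connection
    in every fibre over the horoball form a subgroup.  It contains phi_a(x0.1)
    for every generator x0 and every a: walk to a vertex c' of the horoball with
    phi_c' = phi_a, use the generator there, and walk back. *)
Lemma connected_horoball (g g' : G) : over t g.2 -> over t g'.2 -> E g g'.
Proof.
pose S : {pred B} := fun x =>
  `[< forall b c, over t c -> E (b, c) ((b * x)%g, c) >].
have ST x : x \in S.
  apply: (kernel_generated sG).
    split; first by apply/asboolP => b c oc; rewrite mulg1; apply: Exx.
    move=> x1 x2 /asboolP S1 /asboolP S2; apply/asboolP => b c oc.
    apply: Etrans (S1 _ _ oc) _; apply: Esym.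
    by have := S2 (b * (x1 / x2))%g c oc; rewrite -!mulgA mulVg mulg1.
  move=> a x0 xs; apply/asboolP => b c oc.
  have [c' [oc' ca]] := same_automorphism_in_horoball wker t a.
  apply: Etrans (connected_same_fibre b oc oc') _.
  apply: Etrans (connected_same_fibre (b * phi a x0.1)%g oc' oc).
  by have := E_gen b xs oc'; rewrite ca.
case: g g' => [b c] [b' c'] /= oc oc'.
have /asboolP Sx := ST (b^-1 * b')%g.
by have := Etrans (Sx b c oc) (connected_same_fibre _ oc oc'); rewrite mulVKg.
Qed.

End VertexConnectivity.

(** * Paths *)

Lemma within_continuous_comp (S T U : topologicalType) (A : set S) (B : set T)
    (f : S -> T) (c : T -> U) :
  continuous f -> f @` A `<=` B -> {within B, continuous c} ->
  {within A, continuous (c \o f)}.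
Proof.
move=> fcont fAB /subspace_continuousP ccont.
apply/subspace_continuousP => x Ax.
have Bfx : B (f x) by apply: fAB; exists x.
move=> W /(ccont _ Bfx) /= W'.
have {}W' : \forall y \near x, B (f y) -> W (c (f y)) by apply: fcont W'.
by apply: filterS W' => y W' Ay; apply: W'; apply: fAB; exists y.
Qed.

Lemma bigcup_compact (I : Type) (T : topologicalType) (D : set I)
    (F : I -> set T) :
  finite_set D -> (forall i, D i -> compact (F i)) ->
  compact (\bigcup_(i in D) F i).
Proof.
case/finite_setP=> n; elim: n D => [D|n IH D /eq_cardSP[i Di /IH cD] Fc].
  rewrite II0 => D0 Fc; move: D0.
  by rewrite card_eq0 => /eqP ->; rewrite bigcup_set0; exact: compact0.
have -> : D = i |` (D `\ i) by rewrite setD1K.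
rewrite bigcup_setU1; apply: compactU; first exact: Fc.
by apply: cD => j [Dj _]; apply: Fc.
Qed.

Section Paths.
Context {R : realType} {Y : CW_complex R}.
Implicit Types (P Q : set Y) (y : Y).

Lemma joined_in_refl P y : P y -> joined_in P y y.
Proof.
move=> Py; exists (fun=> y); split=> //; last by move=> _ [x _ <-].
by apply: continuous_subspaceT => x; apply: cvg_cst.
Qed.

Lemma joined_in_sub P Q y y' : P `<=` Q -> joined_in P y y' -> joined_in Q y y'.
Proof. by move=> PQ [c [c1 c2 c3 cP]]; exists c; split=> // z /cP /PQ. Qed.

Lemma joined_in_sym P y y' : joined_in P y y' -> joined_in P y' y.
Proof.
move=> [c [ccont c0 c1 cP]]; exists (c \o (fun x => 1 - x)); split.
- apply: within_continuous_comp ccont.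
    by move=> x; apply: cvgB; [exact: cvg_cst | exact: cvg_id].
  by move=> _ [x /= + <-]; rewrite !in_itv /= => /andP[? ?]; lra.
- by rewrite /= subr0.
- by rewrite /= subrr.
- move=> _ [x /= + <-]; rewrite in_itv /= => /andP[? ?]; apply: cP.
  by exists (1 - x) => //=; rewrite in_itv /=; lra.
Qed.

Lemma joined_in_trans P y' y y'' :
  joined_in P y y' -> joined_in P y' y'' -> joined_in P y y''.
Proof.
move=> [c [ccont c0 c1 cP]] [d [dcont d0 d1 dP]].
pose e (x : R) := if x <= 2^-1 then c (2 * x) else d (2 * x - 1).
have i01 : `[0, 1]%classic = `[0, 2^-1]%classic `|` `[2^-1, 1]%classic :> set R.
  by apply/seteqP; split => x /=; rewrite !in_itv /=; lra.
have mulcont (a : R) : continuous (fun x : R => 2 * x - a).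
  move=> x; apply: cvgB; last exact: cvg_cst.
  by apply: cvgM; [exact: cvg_cst | exact: cvg_id].
exists e; split.
- rewrite i01; apply: withinU_continuous; [exact: itv_closed..| |].
    have := within_continuous_comp (S := R) (A := `[0, 2^-1]%classic)
      (mulcont 0) _ ccont.
    move=> /(_ _)/(subspace_eq_continuous _); apply.
      move=> x /set_mem /=; rewrite in_itv /= => /andP[_ x1].
      by rewrite /from_subspace /e /= x1 subr0.
    by move=> _ [x /= + <-]; rewrite !in_itv /= => /andP[? ?]; lra.
  have := within_continuous_comp (S := R) (A := `[2^-1, 1]%classic)
    (mulcont 1) _ dcont.
  move=> /(_ _)/(subspace_eq_continuous _); apply.
    move=> x /set_mem /=; rewrite in_itv /= => /andP[x0 _].
    rewrite /from_subspace /e /=.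
    case: ifP => // x1; have -> : x = 2^-1 by apply/eqP; rewrite eq_le x0 x1.
    by rewrite mulfV // subrr d0 c1.
  by move=> _ [x /= + <-]; rewrite !in_itv /= => /andP[? ?]; lra.
- by rewrite /e invr_ge0 ler0n mulr0.
- rewrite /e; have /negbTE -> : ~~ (1 <= 2^-1 :> R) by rewrite -ltNge; lra.
  by rewrite mulr1; have -> : (2 - 1 : R) = 1 by lra.
- move=> _ [x /= + <-]; rewrite in_itv /= => /andP[x0 x1]; rewrite /e.
  case: ifP => [x2|/negbT]; last rewrite -ltNge => x2.
    by apply: cP; exists (2 * x) => //=; rewrite in_itv /=; lra.
  by apply: dP; exists (2 * x - 1) => //=; rewrite in_itv /=; lra.
Qed.

Lemma joined_in_image P y y' (f : Y -> Y) : continuous f ->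
  joined_in P y y' -> joined_in (f @` P) (f y) (f y').
Proof.
move=> fcont [c [ccont c0 c1 cP]]; exists (f \o c); split.
- move=> x; apply: (@continuous_comp (subspace _) _ _ c f x (ccont x)).
  exact: fcont.
- by rewrite /= c0.
- by rewrite /= c1.
- by move=> _ [x x01 <-]; exists (c x) => //; apply: cP; exists x.
Qed.

End Paths.

(** * Cells and finite subcomplexes *)

Section Cells.
Context {R : realType} {Y : CW_complex R}.
Implicit Types e : cell Y.

Lemma disk_compact n : compact (disk : set 'rV[R]_n).
Proof.
apply: bounded_closed_compact.
  exists 1; split; first exact: num_real.
  by move=> x x1 y /= y1; apply: le_trans y1 (ltW x1).
apply: (closed_comp _ (@closed_le R 1)) => x _; exact: norm_continuous.
Qed.

Lemma closed_cell_compact e : compact (closed_cell e).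
Proof.
apply: (continuous_compact (@cw_continuous _ _ e)); exact: disk_compact.
Qed.

Lemma open_cell_subset e : open_cell e `<=` closed_cell e.
Proof. by move=> _ [x /= x1 <-]; exists x => //; apply: ltW. Qed.

(** This describes closed cells topologically, so that a homeomorphism permuting
    the open cells permutes the closed cells as well.  A point of the disk is
    approached by its multiples by 1 - s, which lie in the open disk. *)
Lemma closed_cell_closure e : closed_cell e = closure (open_cell e).
Proof.
apply/seteqP; split; last first.
  rewrite closureE; apply: smallest_sub; last exact: open_cell_subset.
  exact: compact_closed (@cw_hausdorff _ Y) (@closed_cell_compact e).
move=> _ [x dx <-] U.
have /subspace_continuousP /(_ x dx) cont := cw_continuous (e := e).
move=> /cont /nbhs_ballP [r /= r0 rU].
pose s : R := Num.min 2^-1 (r / 2).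
have s0 : 0 < s by rewrite lt_min invr_gt0 ltr0n divr_gt0.
have s1 : s <= 2^-1 by rewrite ge_min lexx.
have sr : s < r by rewrite gt_min; apply/orP; right; lra.
have ox : `|(1 - s) *: x| < 1.
  rewrite normrZ ger0_norm; last lra.
  apply: le_lt_trans (_ : (1 - s) * 1 < 1); last by lra.
  by rewrite ler_wpM2l //; lra.
exists (char_map ((1 - s) *: x)); split; first by exists ((1 - s) *: x).
apply: rU; last by apply: ltW.
rewrite -ball_normE /= scalerBl scale1r opprB addrC subrK normrZ gtr0_norm //.
by apply: le_lt_trans sr; rewrite -[leRHS]mulr1 ler_wpM2l // ltW.
Qed.

Lemma open_cell_disjoint e e' y : open_cell e y -> open_cell e' y -> e = e'.
Proof. by move=> ey ey'; apply: cw_disjoint; exists y; split. Qed.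

(** Induction on the dimension: the boundary of e meets only finitely many open
    cells, of smaller dimension, and the carriers of these together with e form
    a carrier of e. *)
Lemma cell_carrier e : exists F : set (cell Y),
  [/\ finite_set F, F e &
      forall e', F e' -> closed_cell e' `<=` \bigcup_(e in F) open_cell e].
Proof.
have [n] := ubnP (cell_dim e); elim: n e => // n IH e en.
have [F0 [F0fin F0dim F0cov]] := cw_finite e.
have /choice [FF FFP] : forall e', exists F : set (cell Y), F0 e' ->
    [/\ finite_set F, F e' &
        forall e', F e' -> closed_cell e' `<=` \bigcup_(e in F) open_cell e].
  move=> e'; have [F0e'|nF0] := pselect (F0 e'); last by exists set0.
  have [|F FP] := IH e'; last by exists F.
  by apply: leq_trans (F0dim _ F0e') _; rewrite -ltnS.
exists ([set e] `|` \bigcup_(e' in F0) FF e'); split; last 2 first.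
- by left.
- move=> e1 [->|[e' F0e' FFe1]].
    move=> _ [x x1 <-]; have [x1'|x1'] := ltP `|x| 1.
      by exists e; [left | exists x].
    have [|e' F0e' e'x] := F0cov (char_map x).
      by exists x => //; apply/eqP; rewrite eq_le x1'; move: x1 => /= ->.
    exists e' => //; right; exists e' => //.
    by have [] := FFP _ F0e'.
  have [_ _ FFcl] := FFP _ F0e'.
  move=> y /(FFcl _ FFe1) [e2 FFe2 e2y]; exists e2 => //.
  by right; exists e'.
rewrite finite_setU; split; first exact: finite_set1.
by apply: bigcup_finite => // e' F0e'; have [] := FFP _ F0e'.
Qed.

Lemma finite_subcomplex (F0 : set (cell Y)) : finite_set F0 ->
  exists K : set Y, [/\ compact K, subcomplex K &
    \bigcup_(e in F0) open_cell e `<=` K].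
Proof.
move=> F0fin; have /choice [FF FFP] := cell_carrier.
pose F := \bigcup_(e in F0) FF e.
have Ffin : finite_set F.
  by apply: bigcup_finite => // e _; have [] := FFP e.
have Fcl e : F e -> closed_cell e `<=` \bigcup_(e in F) open_cell e.
  move=> [e0 F0e0 FFe]; have [_ _ /(_ _ FFe) cl] := FFP e0.
  by move=> y /cl [e1 FFe1 e1y]; exists e1 => //; exists e0.
exists (\bigcup_(e in F) open_cell e); split.
- have -> : \bigcup_(e in F) open_cell e = \bigcup_(e in F) closed_cell e.
    apply/seteqP; split; last by move=> y [e Fe /(Fcl _ Fe)].
    by move=> y [e Fe /open_cell_subset ey]; exists e.
  by apply: bigcup_compact => // e _; exact: closed_cell_compact.
- move=> e [y [ey [e' Fe' e'y]]].
  by rewrite (open_cell_disjoint ey e'y); apply: Fcl.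
- move=> y [e F0e ey]; exists e => //; exists e => //.
  by have [] := FFP e.
Qed.

End Cells.

(** * Subsets that are compact modulo the group *)

Section Orbits.
Context {R : realType} {G : groupType} {Y : GCW_complex R G}.
Implicit Types (e : cell Y) (y z : Y) (Z L K : set Y).

Lemma gactK g : cancel (@gact _ _ Y g) (@gact _ _ Y (g^-1)%g).
Proof. by move=> y; rewrite -gactM mulVg gact1. Qed.

Lemma gactVK g : cancel (@gact _ _ Y (g^-1)%g) (@gact _ _ Y g).
Proof. by move=> y; rewrite -gactM mulgV gact1. Qed.

Definition saturation Z : set Y := [set gact g z | g in setT & z in Z].

Lemma saturation_invariant Z g : gact g @` saturation Z `<=` saturation Z.
Proof.
move=> _ [_ [g' _ [z Zz <-]] <-]; exists (g * g')%g => //.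
by exists z => //; rewrite gactM.
Qed.

Lemma closed_cell_gact g e : exists e',
  gact g @` open_cell e = open_cell e' /\
  gact g @` closed_cell e = closed_cell e'.
Proof.
have clos h e1 e2 : gact h @` open_cell e1 = open_cell e2 ->
    gact h @` closed_cell e1 `<=` closed_cell e2.
  move=> he; rewrite !closed_cell_closure => _ [y ey <-] U /gact_continuous Uy.
  have [z [e1z Uz]] := ey _ Uy; exists (gact h z); split => //.
  by rewrite -he; exists z.
have [e' ge] := gact_cell g e; exists e'; split => //.
apply/seteqP; split; first exact: clos.
have ge' : gact (g^-1)%g @` open_cell e' = open_cell e.
  rewrite -ge; apply/seteqP; split => [_ [_ [y ey <-] <-]|y ey].
    by rewrite gactK.
  by exists (gact g y); [exists y | exact: gactK].
move=> y ey; exists (gact (g^-1)%g y); last exact: gactVK.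
by apply: (clos _ _ _ ge'); exists y.
Qed.

Lemma subcomplex_gact g K : subcomplex K -> subcomplex (gact g @` K).
Proof.
move=> Kcx e [z [ez [k Kk kz]]]; rewrite -{}kz in ez.
have [e' [eo ec]] := closed_cell_gact (g^-1)%g e.
have e'K : closed_cell e' `<=` K.
  apply: Kcx; exists k; split => //; rewrite -eo.
  by exists (gact g k) => //; exact: gactK.
move=> y cy; exists (gact (g^-1)%g y); last exact: gactVK.
by apply: e'K; rewrite -ec; exists y.
Qed.

(** Equality of the G-orbits of the open cells containing y and z, phrased in
    terms of points because the action on the index type of the cells is only
    given through its effect on open cells. *)
Definition same_cell_orbit y z : Prop :=
  exists g e, open_cell e (gact g y) /\ open_cell e z.

Lemma same_cell_orbit_gact g y : same_cell_orbit y (gact g y).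
Proof. by have [e ey] := cw_cover (gact g y); exists g, e. Qed.

Lemma same_cell_orbit_sym y z : same_cell_orbit y z -> same_cell_orbit z y.
Proof.
move=> [g [e [ey ez]]]; have [e' ge] := gact_cell (g^-1)%g e.
exists (g^-1)%g, e'; rewrite -ge; split; first by exists z.
by exists (gact g y) => //; exact: gactK.
Qed.

Lemma same_cell_orbit_trans z y x :
  same_cell_orbit y z -> same_cell_orbit z x -> same_cell_orbit y x.
Proof.
move=> [g [e [ey ez]]] [g' [e' [e'z e'x]]]; have [e1 ge] := gact_cell g' e.
have e1e' : e1 = e' by apply: open_cell_disjoint e'z; rewrite -ge; exists z.
exists (g' * g)%g, e'; split => //.
by rewrite -e1e' -ge gactM; exists (gact g y).
Qed.

(** An open cell meets the orbits of Z in at most one point: two such points lie in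
    one orbit, and a group element carrying one to the other preserves the
    cell, hence fixes it pointwise.  A closed cell is covered by finitely many
    open cells, so it meets G Z in a finite set, which is closed; the weak topology
    does the rest. *)
Lemma closed_saturation Z :
  {in Z &, forall y z, same_cell_orbit y z -> y = z} -> closed (saturation Z).
Proof.
move=> Zinj; apply: cw_weak => e.
have [F [Ffin Fe /(_ _ Fe) ecov]] := cell_carrier e.
pose W := saturation Z `&` closed_cell e.
have Wfin : finite_set W.
  apply: (sub_finite_set
    (B := \bigcup_(e' in F) (saturation Z `&` open_cell e'))).
    by move=> y [Zy /ecov [e' Fe' e'y]]; exists e'.
  apply: bigcup_finite => // e' _.
  have [->|] := eqVneq (saturation Z `&` open_cell e') set0.
    exact: finite_set0.
  move=> /set0P [y0 [[g0 _ [z0 Zz0 gz0]] e'y0]].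
  apply: (sub_finite_set _ (finite_set1 y0)) => y [[g _ [z Zz gz]] e'y] /=.
  have zz0 : z = z0.
    apply: Zinj; rewrite ?inE //.
    apply: same_cell_orbit_trans (same_cell_orbit_gact g z) _.
    apply: same_cell_orbit_sym.
    apply: same_cell_orbit_trans (same_cell_orbit_gact g0 z0) _.
    by exists 1%g, e'; rewrite gact1 gz0 gz.
  rewrite -zz0 in gz0.
  have yE : y = gact (g * g0^-1)%g y0.
    by rewrite gactM -gz0 gactK.
  have [e1 ge] := gact_cell (g * g0^-1)%g e'.
  have e1e' : e1 = e'.
    by apply: open_cell_disjoint e'y; rewrite -ge yE; exists y0.
  by rewrite yE; apply: (gact_rigid (e := e')) => //; rewrite ge e1e'.
have -> : disk `&` char_map (c := Y) (e := e) @^-1` saturation Z =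
          disk `&` char_map (c := Y) (e := e) @^-1` W.
  apply/seteqP; split=> x [dx xZ]; split=> //; last by case: xZ.
  by split => //; exists x.
have dcl : closed (disk : set 'rV[R]_(cell_dim e)).
  exact: compact_closed (@norm_hausdorff _ _) (@disk_compact R _).
rewrite closed_setSI //.
move: (@cw_continuous _ Y e) => /continuous_closedP; apply.
move: W Wfin {Zinj}; apply/accessible_finite_set_closed.
exact/hausdorff_accessible/cw_hausdorff.
Qed.

Lemma orbit_mapP y z : orbit_map y = orbit_map z <-> exists g, z = gact g y.
Proof.
split.
  by move=> /eqmodP /asboolP.
by move=> yz; apply/eqmodP/asboolP.
Qed.

Lemma closed_orbit_image Z :
  closed (saturation Z) -> closed (@orbit_map _ _ Y @` Z).
Proof.
move=> cZ; rewrite -openC /open /= /quotient_open.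
suff -> : \pi_(orbit_space Y)%qT @^-1` (~` (@orbit_map _ _ Y @` Z)) =
    ~` saturation Z.
  exact: closed_openC.
rewrite preimage_setC; congr (~` _); apply/seteqP; split.
  by move=> y [z Zz /orbit_mapP [g ->]]; exists g => //; exists z.
by move=> _ [g _ [z Zz <-]]; exists z => //; apply/orbit_mapP; exists g.
Qed.

Lemma orbit_map_continuous : continuous (@orbit_map _ _ Y).
Proof. exact: pi_continuous. Qed.

(** Choose one point of L in each orbit of open cells that L meets.  By
    [closed_saturation] every set of chosen points has closed image in the orbit
    space, so the chosen points form a closed discrete subset of a compact set and
    are finite in number.  Finitely many orbits of cells are covered by the
    translates of a finite subcomplex. *)
Lemma compact_orbit_cover L : compact (@orbit_map _ _ Y @` L) ->
  exists K, [/\ compact K, subcomplex K & L `<=` saturation K].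
Proof.
move=> Lcpt; have [L0|/set0P [y0 Ly0]] := eqVneq L set0.
  have [K [Kc Kcx _]] := @finite_subcomplex _ Y set0 (finite_set0 _).
  by exists K; split => //; rewrite L0.
pose rep y := xget y0 [set z | L z /\ same_cell_orbit y z].
have repP y : L y -> L (rep y) /\ same_cell_orbit y (rep y).
  move=> Ly; apply: (xgetPex y0 (P := [set z | L z /\ same_cell_orbit y z])).
  exists y; split => //; rewrite -[X in same_cell_orbit _ X]gact1.
  exact: same_cell_orbit_gact.
have rep_eq y z : same_cell_orbit y z -> rep y = rep z.
  move=> yz; rewrite /rep; congr xget.
  apply/seteqP; split => x /= [Lx ?]; split => //.
    exact: same_cell_orbit_trans (same_cell_orbit_sym yz) _.
  exact: same_cell_orbit_trans yz _.
pose D := rep @` L.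
have Drep d : D d -> rep d = d.
  by move=> [y Ly <-]; apply: esym; apply: rep_eq; have [] := repP _ Ly.
have Dinj d d' : D d -> D d' -> same_cell_orbit d d' -> d = d'.
  by move=> Dd Dd' dd'; rewrite -(Drep _ Dd) -(Drep _ Dd'); apply: rep_eq.
have DL d : D d -> L d by move=> [y Ly <-]; have [] := repP _ Ly.
have Dfin : finite_set D.
  apply: contrapT => Dinf.
  (* Were D infinite, the complements of its finite subsets would have closed
     images with the finite intersection property but no common point. *)
  pose tails := filter_from [set E | finite_set E]
    (fun E => @orbit_map _ _ Y @` (D `\` E)).
  have tails_proper : ProperFilter tails.
    apply: filter_from_proper.
      apply: filter_from_filter; first by exists set0; exact: finite_set0.
      move=> E E' Efin E'fin; exists (E `|` E').
        by rewrite /= finite_setU.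
      by move=> _ [d [Dd dEE'] <-]; split; exists d => //; split => // ?;
        apply: dEE'; [left|right].
    move=> E Efin; have [d [Dd dE]] : D `\` E !=set0.
      apply/set0P/eqP => DE; apply: Dinf; apply: sub_finite_set Efin.
      move=> d Dd; apply: contrapT => nE.
      by have : (D `\` E) d by []; rewrite DE.
    by exists (orbit_map d), d.
  have tail_closed E : closed (@orbit_map _ _ Y @` (D `\` E)).
    apply: closed_orbit_image; apply: closed_saturation.
    by move=> y z /set_mem [Dy _] /set_mem [Dz _]; exact: Dinj.
  have [|p [_ pcl]] := Lcpt tails tails_proper.
    exists set0; first exact: finite_set0.
    by move=> _ [d [Dd _] <-]; exists d => //; exact: DL.
  have ptail E : finite_set E -> (@orbit_map _ _ Y @` (D `\` E)) p.
    move=> Efin; apply: (tail_closed E) => U Up.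
    have tE : tails (@orbit_map _ _ Y @` (D `\` E)) by exists E.
    by have [q [qE Uq]] := pcl _ _ tE Up; exists q.
  have [d [Dd _] dp] := ptail set0 (finite_set0 _).
  have [d' [Dd' d'd] d'p] := ptail _ (finite_set1 d).
  apply: d'd; apply: Dinj => //; apply: same_cell_orbit_sym.
  have /orbit_mapP [g gd] : orbit_map d = orbit_map d' by rewrite dp d'p.
  by rewrite gd; exact: same_cell_orbit_gact.
have /choice [cellof cellofP] := @cw_cover _ Y.
have [K [Kc Kcx KD]] := finite_subcomplex (finite_image cellof Dfin).
exists K; split => // y Ly.
have [_ [g [e [ey erep]]]] := repP _ Ly.
exists (g^-1)%g => //; exists (gact g y); last exact: gactK.
apply: KD; exists e => //; exists (rep y); first by exists y.
exact: open_cell_disjoint (cellofP _) erep.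
Qed.

End Orbits.

Section Cocompact.
Context {R : realType} {G : groupType} {Y : GCW_complex R G}.
Implicit Types K P L : set Y.

Lemma orbit_image_saturation K :
  @orbit_map _ _ Y @` saturation K = @orbit_map _ _ Y @` K.
Proof.
apply/seteqP; split=> [_ [_ [g _ [k Kk <-]] <-]|_ [k Kk <-]].
  by exists k => //; apply/orbit_mapP; exists g.
by exists k => //; exists 1%g => //; exists k => //; rewrite gact1.
Qed.

Lemma cocompact_saturation K : compact K -> cocompact_subspace (saturation K).
Proof.
move=> Kc; split; first exact: saturation_invariant.
rewrite orbit_image_saturation; apply: continuous_compact => //.
by apply: continuous_subspaceT; exact: orbit_map_continuous.
Qed.

End Cocompact.

Lemma compact_mdist_bounded (R : realType) (T : topologicalType)
    (M : metricType R) (h : T -> M) (K : set T) (v : M) :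
  continuous h -> compact K ->
  exists D : R, 0 <= D /\ forall y, K y -> mdist v (h y) <= D.
Proof.
move=> hcont /compact_near_coveringP Kc.
have [] := Kc R +oo (fun D y => mdist v (h y) <= D) _ _.
  move=> x _.
  exists ([set y | mdist (h x) (h y) < 1], [set D | mdist v (h x) + 1 <= D]).
    split; last by apply: nbhs_pinfty_ge; rewrite num_real.
    have Bx : nbhs (h x) [set p | mdist (h x) p < 1].
      by rewrite -(ballEmdist (h x) 1); exact: nbhsx_ballx.
    exact: (hcont x _ Bx).
  move=> [y D] [/= hxy Dx]; apply: le_trans (metric_triangle _ (h x) _) _.
  by apply: le_trans Dx; rewrite lerD2l ltW.
move=> D [_ DK]; exists (Num.max 0 (D + 1)); split.
  by rewrite le_max lexx.
move=> y Ky; apply: le_trans (DK (D + 1) _ _ Ky) _; first by rewrite ltrDl.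
by rewrite le_max lexx orbT.
Qed.

(** * Control over horoballs *)

Section ControlMap.
Context {R : realType} {G : groupType} {M : metricType R}.
Context (rho : isometric_action G M) (Y : GCW_complex R G) (h : Y -> M).
Context (hcontrol : control_map rho h) (tau : R -> M).

Lemma mdist_gact g y z :
  mdist (h (gact g y)) (h (gact g z)) = mdist (h y) (h z).
Proof. by have [_ hg] := hcontrol; rewrite !hg iact_isometry. Qed.

(** The translate of K through y is a subcomplex, and its image under h has
    diameter at most 2 D, so it lies over a horoball that is larger by 2 D. *)
Lemma over_horoball_saturation (K : set Y) v D t y : subcomplex K ->
  (forall k, K k -> mdist v (h k) <= D) -> saturation K y ->
  horoball tau t (h y) -> over_horoball h tau (t - 2 * D) y.
Proof.
move=> Kcx KD [g _ [k Kk <-]] hy; exists (gact g @` K); last by exists k.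
split; first exact: subcomplex_gact.
move=> _ [k' Kk' <-]; apply: horoball_mdist hy.
rewrite mdist_gact; apply: le_trans (metric_triangle _ v _) _.
by rewrite metric_sym; have := KD _ Kk; have := KD _ Kk'; lra.
Qed.

Lemma over_horoball_sub t y : over_horoball h tau t y -> horoball tau t (h y).
Proof. by move=> [Z [_ Zh] Zy]; exact: Zh. Qed.

End ControlMap.

(** P is the set swept out by K under the contraction. *)
Lemma contraction_track (R : realType) (Y : CW_complex R) (y0 : Y)
    (H : Y * R -> Y) (K : set Y) :
  {within [set p | 0 <= p.2 <= 1], continuous H} ->
  (forall y, H (y, 0) = y) -> (forall y, H (y, 1) = y0) -> compact K ->
  exists P, [/\ compact P, K `<=` P & forall y, K y -> joined_in P y y0].
Proof.
move=> Hcont H0 H1 Kc; exists (H @` (K `*` (`[0, 1]%classic : set R))); split.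
- have KI : compact (K `*` (`[0, 1]%classic : set R)).
    by apply: compact_setX => //; exact: segment_compact.
  apply: continuous_compact KI.
  by apply: (continuous_subspaceW _ Hcont) => -[y x] [_] /=; rewrite in_itv.
- move=> y Ky; exists (y, 0) => //; split => //=.
  by rewrite in_itv /= lexx ler01.
move=> y Ky; exists (H \o (fun x => (y, x))); split => //=.
  apply: (within_continuous_comp (f := fun x : R => (y, x)) _ _ Hcont).
    move=> x.
    have := @cvg_pair _ _ _ (nbhs x) (nbhs y) (nbhs x) _ _ _ (fun=> y) id.
    by apply; [exact: cvg_cst | exact: cvg_id].
  by move=> _ [x /= + <-]; rewrite in_itv.
by move=> _ [x x01 <-]; exists (y, x).
Qed.

Theorem theorem3 (R : realType) (A B : groupType) (X : free_basis A)
    (phi : {multiplicative A -> Aut B})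
    (Gfg : finitely_generated (semidirect phi))
    (w : infinite_word X)
    (wker : infinitely_many_subwords_in_kernel phi w) :
  Sigma1 (tree_action R X phi) w.
Proof.
move=> Y h _ [y0 [H [Hcont H0 H1]]] hcontrol L [Linv Lcpt].
have [hcont hequiv] := hcontrol.
have [K [Kc _ LK]] := compact_orbit_cover Lcpt.
have [s sG] := Gfg.
pose basis_elt i : semidirect phi := (1%g, X i).
pose kernel_elt (x : semidirect phi) : semidirect phi := (x.1, 1%g).
(* Tracks of y0 and its translates give the edges of the Cayley graph of G at
   the identity; tracks of K join the points of L to the orbit of y0. *)
pose K1 : set Y := K `|` [set y0]
  `|` [set gact (basis_elt i) y0 | i in setT]
  `|` [set gact (kernel_elt x) y0 | x in [set` s]].
have K1c : compact K1.
  repeat apply: compactU => //; first exact: compact_set1.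
    by apply/finite_compact/finite_image/finite_finset.
  by apply/finite_compact/finite_image/finite_seq.
have [P [Pc K1P Pjoin]] := contraction_track Hcont H0 H1 K1c.
have [K' [K'c K'cx PK']] := compact_orbit_cover (cocompact_saturation Pc).2.
have LP : L `<=` saturation P.
  move=> y /LK [g _ [k Kk <-]]; exists g => //; exists k => //.
  by apply: K1P; do 3 left.
have [D1 [D1ge D1P]] := compact_mdist_bounded (Vertex 1%g) hcont Pc.
have [D2 [D2ge D2K]] := compact_mdist_bounded (Vertex 1%g) hcont K'c.
(* Passing from L to a vertex and from the vertex to a translate of P costs D1
   each; passing from there to a subcomplex costs 2 D2. *)
pose C := 2 * D1 + 2 * D2.
have vertex_near (g : semidirect phi) p : P p ->
    mdist (Vertex g.2) (h (gact g p)) <= D1.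
  move=> Pp; rewrite hequiv.
  rewrite -[Vertex g.2](_ : translate g.2 (Vertex 1%g) = _).
    by rewrite translate_isometry; exact: D1P.
  by rewrite /= mulg1.
have translate_over t (g : semidirect phi) :
    horoball (ray w) (t - D1) (Vertex g.2) ->
    gact g @` P `<=` over_horoball h (ray w) (t - C) `&` saturation K'.
  move=> tg _ [p Pp <-].
  have Py : saturation P (gact g p) by exists g => //; exists p.
  split; last exact: PK'.
  have -> : t - C = t - D1 - D1 - 2 * D2 by rewrite /C; lra.
  apply: (over_horoball_saturation hcontrol K'cx D2K (PK' _ Py)).
  exact: horoball_mdist (vertex_near g p Pp) tg.
have joined_over t y y' : (over_horoball h (ray w) t `&` L) y ->
    (over_horoball h (ray w) t `&` L) y' ->
    joined_in (over_horoball h (ray w) (t - C) `&` saturation K') y y'.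
  pose Q := over_horoball h (ray w) (t - C) `&` saturation K'.
  have join_translate (g : semidirect phi) k : K1 k ->
      horoball (ray w) (t - D1) (Vertex g.2) ->
      joined_in Q (gact g k) (gact g y0).
    move=> K1k tg; apply: joined_in_sub (translate_over t g tg) _.
    by apply: joined_in_image; [exact: gact_continuous | exact: Pjoin].
  have to_orbit x : (over_horoball h (ray w) t `&` L) x ->
      exists g : semidirect phi,
      horoball (ray w) (t - D1) (Vertex g.2) /\ joined_in Q x (gact g y0).
    move=> [/over_horoball_sub tx /LK [g _ [k Kk gk]]]; exists g.
    have K1k : K1 k by do 3 left.
    have tg : horoball (ray w) (t - D1) (Vertex g.2).
      apply: horoball_mdist tx; rewrite metric_sym -gk.
      by apply: vertex_near; exact: K1P.
    by split => //; rewrite -gk; exact: join_translate.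
  move=> /to_orbit [g [tg yg]] /to_orbit [g' [tg' yg']].
  apply: joined_in_trans yg _; apply: joined_in_trans (joined_in_sym yg').
  apply: (connected_horoball (R := R) (t := t - D1) wker
    (E := fun g g' => joined_in Q (gact g y0) (gact g' y0)) sG) => //.
  - move=> g1 tg1; apply: joined_in_refl; apply: (translate_over t g1 tg1).
    by exists y0 => //; apply: K1P; do 2 left; right.
  - by move=> g1 g2; exact: joined_in_sym.
  - by move=> g1 g2 g3; exact: joined_in_trans.
  - move=> b c i tc; apply: joined_in_sym.
    pose g1 : semidirect phi := (b, c).
    have -> : ((b, c * X i) : semidirect phi)%g = (g1 * basis_elt i)%g.
      by rewrite semidirect_mulE phi_1 mulg1.
    rewrite gactM; apply: (join_translate g1) => //.
    by left; right; exists i.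
  - move=> b c x xs tc; apply: joined_in_sym.
    pose g1 : semidirect phi := (b, c).
    have -> : ((b * phi c x.1, c) : semidirect phi)%g = (g1 * kernel_elt x)%g.
      by rewrite semidirect_mulE mulg1.
    rewrite gactM; apply: (join_translate g1) => //.
    by right; exists x.
exists (saturation K'); split.
- exact: cocompact_saturation.
- by move=> y /LP /PK'.
move=> t; exists C; split.
- by rewrite /C; lra.
- exact: joined_over.
by move=> y y' yt y't; have := joined_over _ _ _ yt y't; rewrite addrK.
Qed.
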